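(* Let $X$ be a compact Hausdorff space, $F$ a Banach lattice and $T:C(X)\to F$ a disjointness preserving linear operator, with singularity set $\mathcal{F}_T$. Then the following hold. (1) $\mathcal{F}_T=\emptyset$ if and only if $T$ is continuous. (2) $\mathcal{F}_T$ is a finite set. (3) Assume $\mathcal{F}_T\neq\emptyset$ and $\mathcal{F}_T=\{x_1,\dots,x_n\}$ (with $x_1,\dots,x_n$ distinct). Then there exist a continuous disjointness preserving linear operator $R:C(X)\to F$ and disjointness preserving linear operators $S_i:C(X)\to F$ ($1\le i\le n$) such that $T=R+S_1+\dots+S_n$. Moreover, $S_i|_{M_{x_i}}\neq 0$ and $S_i|_{J_{x_i}}=0$ for each $1\le i\le n$.
   Context: $C(X)$ is the Banach lattice of real continuous functions on $X$ with the supremum norm. Elements $f,g$ of a Banach lattice are disjoint, $f\perp g$, if $|f|\wedge|g|=0$. A linear operator (not assumed continuous) is disjointness preserving if it maps disjoint elements to disjoint elements. For $x\in X$, $\mathcal{N}_x$ is the collection of open neighborhoods of $x$. For an open set $U\subset X$, $K_U=\{f\in C(X): f(y)=0\text{ for all }y\in X\setminus U\}$. A point $x\in X$ is a singularity point of $T$ if for every $U\in\mathcal{N}_x$ the restriction $T|_{K_U}:K_U\to F$ is discontinuous; the singularity set $\mathcal{F}_T$ is the set of all singularity points of $T$. For $x\in X$, $M_x=\{f\in C(X):f(x)=0\}$, and $J_x$ is the set of all $f\in C(X)$ which vanish on some open neighborhood of $x$. *)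

(* Defs.v *)
From HB Require Import structures.
From mathcomp Require Import all_boot all_order all_algebra.
From mathcomp Require Import all_classical all_reals all_analysis.
From mathcomp Require Import lra.

Set Implicit Arguments.
Unset Strict Implicit.
Unset Printing Implicit Defensive.

Import Order.TTheory GRing.Theory Num.Theory.
Import numFieldNormedType.Exports.

Local Open Scope classical_set_scope.
Local Open Scope ring_scope.

(* The order is carried by the mixin itself rather than by [Order.Lattice]:
   the library's hierarchy, where [Num.RealDomain] is already the join of the
   ordered and the additive structures, leaves no room for another structure
   inheriting from both. *)
HB.mixin Record isVectorLattice (R : numDomainType) V & GRing.Lmodule R V := {
  vle : V -> V -> Prop ;
  vmeet : V -> V -> V ;
  vjoin : V -> V -> V ;
  vle_refl : forall x, vle x x ;
  vle_anti : forall x y, vle x y -> vle y x -> x = y ;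
  vle_trans : forall y x z, vle x y -> vle y z -> vle x z ;
  vmeetP : forall x y z, vle z (vmeet x y) <-> vle z x /\ vle z y ;
  vjoinP : forall x y z, vle (vjoin x y) z <-> vle x z /\ vle y z ;
  vleD2l : forall z x y, vle x y -> vle (z + x) (z + y) ;
  vleZ2l : forall (a : R) x y, 0 <= a -> vle x y -> vle (a *: x) (a *: y)
}.

#[short(type="vectorLatticeType")]
HB.structure Definition VectorLattice (R : numDomainType) :=
  {V of GRing.Lmodule R V & isVectorLattice R V}.

(* The lattice absolute value; [`|x|] is reserved for the norm. *)
Definition vabs (R : numDomainType) (V : vectorLatticeType R) (x : V) : V :=
  vjoin x (- x).

Definition vdisjoint (R : numDomainType) (V : vectorLatticeType R) (x y : V) :=
  vmeet (vabs x) (vabs y) = 0.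

Definition disjointness_preserving (R : numDomainType)
    (V W : vectorLatticeType R) (T : V -> W) :=
  forall x y : V, vdisjoint x y -> vdisjoint (T x) (T y).

HB.mixin Record isBanachLattice (R : numFieldType) V
    & VectorLattice R V & CompleteNormedModule R V := {
  ler_norm_vabs : forall x y : V, vle (vabs x) (vabs y) -> `|x| <= `|y|
}.

#[short(type="banachLatticeType")]
HB.structure Definition BanachLattice (R : numFieldType) :=
  {V of VectorLattice R V & CompleteNormedModule R V & isBanachLattice R V}.

HB.mixin Record isCompactHausdorff X & Topological X := {
  compact_space : compact [set: X] ;
  hausdorff_sep : hausdorff_space X
}.

#[short(type="compactHausdorffType")]
HB.structure Definition CompactHausdorff :=
  {X of Topological X & isCompactHausdorff X}.

(* An alias of [continuousType X R]: the latter carries the compact-open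
   topology in the library, whereas here the topology is that of the norm. *)
Definition Cfun (X : compactHausdorffType) (R : realType) : Type :=
  continuousType X R.

Section Cfun_banach_lattice.
Context (X : compactHausdorffType) (R : realType).
Local Notation C := (Cfun X R).

Definition mkCfun (f : X -> R) (cf : continuous f) : C :=
  mkcts cf : continuousType X R.

HB.instance Definition _ := Choice.copy C (continuousType X R).

Lemma Cfun_eqP (f g : C) : (forall x, f x = g x) -> f = g.
Proof. by move=> fg; apply/continuousEP. Qed.

Lemma Cfun_cts (f : C) : continuous (f : X -> R).
Proof. exact: (@cts_fun _ _ (f : continuousType X R)). Qed.

Let czero : continuous (fun _ : X => 0 : R).
Proof. exact: cst_continuous. Qed.

Let copp (f : C) : continuous (fun x => - f x).
Proof. by move=> x; apply: continuousN; exact: Cfun_cts. Qed.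

Let cadd (f g : C) : continuous (fun x => f x + g x).
Proof. by move=> x; apply: continuousD; exact: Cfun_cts. Qed.

Let cscale (a : R) (f : C) : continuous (fun x => a * f x).
Proof.
by move=> x; apply: continuousM; [exact: cst_continuous|exact: Cfun_cts].
Qed.

Let cmin (f g : C) : continuous (fun x => Num.min (f x) (g x)).
Proof. by move=> x; apply: continuous_min; exact: Cfun_cts. Qed.

Let cmax (f g : C) : continuous (fun x => Num.max (f x) (g x)).
Proof. by move=> x; apply: continuous_max; exact: Cfun_cts. Qed.

Let addf f g := mkCfun (@cadd f g).
Let oppf f := mkCfun (@copp f).
Let scalef a f := mkCfun (@cscale a f).

Let addfA : associative addf.
Proof. by move=> f g h; apply: Cfun_eqP => x; exact: addrA. Qed.

Let addfC : commutative addf.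
Proof. by move=> f g; apply: Cfun_eqP => x; exact: addrC. Qed.

Let add0f : left_id (mkCfun czero) addf.
Proof. by move=> f; apply: Cfun_eqP => x; exact: add0r. Qed.

Let addNf : left_inverse (mkCfun czero) oppf addf.
Proof. by move=> f; apply: Cfun_eqP => x; exact: addNr. Qed.

HB.instance Definition _ := GRing.isZmodule.Build C addfA addfC add0f addNf.

Let scalefA a b f : scalef a (scalef b f) = scalef (a * b) f.
Proof. by apply: Cfun_eqP => x; exact: mulrA. Qed.

Let scale1f : left_id 1 scalef.
Proof. by move=> f; apply: Cfun_eqP => x; exact: mul1r. Qed.

Let scalefDr : right_distributive scalef +%R.
Proof. by move=> a f g; apply: Cfun_eqP => x; exact: mulrDr. Qed.

Let scalefDl f : {morph scalef^~ f : a b / a + b}.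
Proof. by move=> a b; apply: Cfun_eqP => x; exact: mulrDl. Qed.

HB.instance Definition _ := GRing.Zmodule_isLmodule.Build R C
  scalefA scale1f scalefDr scalefDl.

Let lef (f g : C) : Prop := forall x, f x <= g x.

Let lef_refl f : lef f f.
Proof. by []. Qed.

Let lef_anti f g : lef f g -> lef g f -> f = g.
Proof.
by move=> fg gf; apply: Cfun_eqP => x; apply/le_anti; rewrite fg gf.
Qed.

Let lef_trans g f h : lef f g -> lef g h -> lef f h.
Proof. by move=> fg gh x; exact: le_trans (fg x) (gh x). Qed.

Let minf f g := mkCfun (@cmin f g).
Let maxf f g := mkCfun (@cmax f g).

Let lef_min f g h : lef h (minf f g) <-> lef h f /\ lef h g.
Proof.
have E x : (h x <= minf f g x) = (h x <= f x) && (h x <= g x).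
  exact: le_min.
split=> [hfg|[hf hg] x]; last by rewrite E hf hg.
by split=> x; have := hfg x; rewrite E => /andP[].
Qed.

Let gef_max f g h : lef (maxf f g) h <-> lef f h /\ lef g h.
Proof.
have E x : (maxf f g x <= h x) = (f x <= h x) && (g x <= h x).
  exact: ge_max.
split=> [fgh|[fh gh] x]; last by rewrite E fh gh.
by split=> x; have := fgh x; rewrite E => /andP[].
Qed.

Lemma Cfun0E x : (0 : C) x = 0. Proof. by []. Qed.
Lemma CfunDE (f g : C) x : (f + g) x = f x + g x. Proof. by []. Qed.
Lemma CfunNE (f : C) x : (- f) x = - f x. Proof. by []. Qed.
Lemma CfunZE a (f : C) x : (a *: f) x = a * f x. Proof. by []. Qed.

Let lef_add h f g : lef f g -> lef (h + f) (h + g).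
Proof. by move=> fg x; rewrite !CfunDE lerD2l. Qed.

Let lef_scale (a : R) f g : 0 <= a -> lef f g -> lef (a *: f) (a *: g).
Proof. by move=> a0 fg x; rewrite !CfunZE ler_wpM2l. Qed.

HB.instance Definition _ := isVectorLattice.Build R C
  lef_refl lef_anti lef_trans lef_min gef_max lef_add lef_scale.

Lemma Cfun_leE (f g : C) : vle f g = (forall x, f x <= g x).
Proof. by []. Qed.
Lemma Cfun_meetE (f g : C) x : vmeet f g x = Num.min (f x) (g x).
Proof. by []. Qed.
Lemma Cfun_joinE (f g : C) x : vjoin f g x = Num.max (f x) (g x).
Proof. by []. Qed.

Lemma Cfun_vabsE (f : C) x : vabs f x = `|f x|.
Proof. by rewrite /vabs Cfun_joinE CfunNE maxrN. Qed.

(* When [X] is empty this is [sup set0 = 0]. *)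
Definition sup_norm (f : C) : R := sup [set `|f x| | x in [set: X]].

Lemma sup_norm_has_ub (f : C) : has_ubound [set `|f x| | x in [set: X]].
Proof.
have cA : compact ((f : X -> R^o) @` setT).
  apply: continuous_compact; last exact: compact_space.
  by apply: continuous_subspaceT => x; exact: Cfun_cts.
have [M [_ MA]] := compact_bounded cA.
exists (M + 1) => _ [x _ <-]; apply: (MA (M + 1)); first by rewrite ltrDl.
by exists x.
Qed.

Lemma sup_norm_ub (f : C) x : `|f x| <= sup_norm f.
Proof. by apply: ub_le_sup; [exact: sup_norm_has_ub|exists x]. Qed.

Lemma sup_norm_le (f : C) (M : R) :
  0 <= M -> (forall x, `|f x| <= M) -> sup_norm f <= M.
Proof.
move=> M0 fM; rewrite /sup_norm; set A := (X in sup X).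
have [->|/set0P A0] := eqVneq A set0; first by rewrite sup0.
by apply: ge_sup => // _ [x _ <-].
Qed.

Lemma sup_norm_ge0 (f : C) : 0 <= sup_norm f.
Proof.
rewrite /sup_norm; set A := (X in sup X).
have [->|/set0P[_ [x _ _]]] := eqVneq A set0; first by rewrite sup0.
exact: le_trans (normr_ge0 _) (sup_norm_ub f x).
Qed.

Let sup_normD (f g : C) : sup_norm (f + g) <= sup_norm f + sup_norm g.
Proof.
apply: sup_norm_le => [|x]; first by rewrite addr_ge0 ?sup_norm_ge0.
by rewrite CfunDE (le_trans (ler_normD _ _))// lerD ?sup_norm_ub.
Qed.

Let sup_normZ (a : R) (f : C) : sup_norm (a *: f) = `|a| * sup_norm f.
Proof.
have le_scale b g : sup_norm (b *: g) <= `|b| * sup_norm g.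
  apply: sup_norm_le => [|x]; first by rewrite mulr_ge0 ?sup_norm_ge0.
  by rewrite CfunZE normrM ler_wpM2l ?sup_norm_ub.
apply/le_anti; rewrite le_scale /=.
have [->|a0] := eqVneq a 0; first by rewrite normr0 mul0r sup_norm_ge0.
have := le_scale a^-1 (a *: f).
by rewrite scalerA mulVf// scale1r normfV ler_pdivlMl// normr_gt0.
Qed.

Let sup_norm0_eq0 (f : C) : sup_norm f = 0 -> f = 0.
Proof.
move=> f0; apply: Cfun_eqP => x; apply/normr0_eq0/le_anti.
by rewrite normr_ge0 andbT -f0 sup_norm_ub.
Qed.

HB.instance Definition _ := @Lmodule_isNormed.Build R C
  sup_norm sup_normD sup_normZ sup_norm0_eq0.

Lemma Cfun_normE (f : C) : `|f| = sup_norm f. Proof. by []. Qed.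

Lemma Cfun_ball_lt (f g : C) (e : R) x : ball f e g -> `|f x - g x| < e.
Proof.
rewrite -ball_normE/= => fg; apply: le_lt_trans fg.
exact: (sup_norm_ub (f - g) x).
Qed.

Let Cfun_complete (F : set_system C) : ProperFilter F -> cauchy F -> cvg F.
Proof.
move=> FF Fc.
have cvx x : cvg ((fun f : C => f x : R) @ F).
  apply: R_complete; apply: cauchy_exP => e e0.
  have [f Ff] := (cauchyP F).1 Fc e e0.
  exists (f x); rewrite nbhs_simpl/= -ball_normE/=.
  by apply: filterS Ff => g; exact: Cfun_ball_lt.
pose l x : R := lim ((fun f : C => f x : R) @ F).
have Fl e : 0 < e -> F [set f : C | forall x, `|l x - f x| <= e].
  move=> e0; have e30 : 0 < e / 3 by rewrite divr_gt0.
  have [f Ff] := (cauchyP F).1 Fc _ e30.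
  apply: filterS (Ff) => g fg x.
  have /cvgrPdist_lt/(_ _ e30) lx : (fun f : C => f x : R) @ F --> l x.
    exact: cvx.
  have [h [/= lh fh]] := filter_ex (filterI lx Ff).
  have {}fh := Cfun_ball_lt x fh; have {}fg := Cfun_ball_lt x fg.
  move: lh fh fg; rewrite !ltr_distl ler_distl => *; lra.
have cl : continuous l.
  move=> x; apply/cvgrPdist_le => e e0.
  have e30 : 0 < e / 3 by rewrite divr_gt0.
  have [f fl] := filter_ex (Fl _ e30).
  have /cvgrPdist_le/(_ _ e30) : (f y : R) @[y --> x] --> (f x : R).
    exact: Cfun_cts.
  apply: filterS => y fxy.
  by move: (fl x) (fl y) fxy; rewrite !ler_distl => *; lra.
apply/cvg_ex; exists (mkCfun cl); apply/cvgrPdist_le => e e0.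
apply: filterS (Fl e e0) => f lf.
by apply: sup_norm_le => [|x]; [exact: ltW|exact: lf].
Qed.

HB.instance Definition _ := Uniform_isComplete.Build C Cfun_complete.

Let Cfun_norm_vabs (f g : C) : vle (vabs f) (vabs g) -> `|f| <= `|g|.
Proof.
move=> fg; apply: sup_norm_le => [|x]; first exact: sup_norm_ge0.
by rewrite -Cfun_vabsE (le_trans (fg x))// Cfun_vabsE sup_norm_ub.
Qed.

HB.instance Definition _ := isBanachLattice.Build R C Cfun_norm_vabs.

End Cfun_banach_lattice.

Section singularity.
Context (R : realType) (X : compactHausdorffType).

Definition K_ (U : set X) : set (Cfun X R) :=
  [set f | forall y, (~` U) y -> f y = 0].

Definition M_ (x : X) : set (Cfun X R) := [set f | f x = 0].

Definition J_ (x : X) : set (Cfun X R) :=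
  [set f | exists2 U, open_nbhs x U & forall y, U y -> f y = 0].

Definition singularity_point (F : banachLatticeType R) (T : Cfun X R -> F)
    (x : X) :=
  forall U, open_nbhs x U -> ~ {within K_ U, continuous T}.

Definition singularity_set (F : banachLatticeType R) (T : Cfun X R -> F) :
    set X :=
  [set x | singularity_point T x].

End singularity.

(* Main.v *)
(* By a gliding hump argument, every point [p] has a neighborhood [W] such that
   [T] is bounded on the functions supported in [W] and vanishing near [p], so
   singularity points are isolated, hence finite in number by compactness.  For
   the decomposition, the same argument bounds [T] on the functions vanishing
   near all the [x i], and so on the space [L] of those that are constant near
   each [x i].  [L] is dense, and [R0] is the continuous extension of the
   restriction of [T] to [L]; it preserves disjointness because disjoint
   functions can be approximated by disjoint elements of [L].  With disjoint
   bumps [e i] equal to [1] near [x i], the operators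
   [S i f = (T - R0) (e i * f)] add up to [T - R0], which vanishes on [L]. *)

Require Import Defs.
From HB Require Import structures.
From mathcomp Require Import all_boot all_order all_algebra.
From mathcomp Require Import all_classical all_reals all_analysis.
From mathcomp Require Import ring lra.

Set Implicit Arguments.
Unset Strict Implicit.
Unset Printing Implicit Defensive.

Import Order.TTheory GRing.Theory Num.Theory.
Import numFieldNormedType.Exports.

Local Open Scope classical_set_scope.
Local Open Scope ring_scope.

(** * Disjointness in vector and Banach lattices *)

Section vector_lattice.
Context (R : numFieldType) (V : vectorLatticeType R).
Implicit Types x y z : V.

Lemma vmeet_lel x y : vle (vmeet x y) x.
Proof. exact: ((vmeetP x y _).1 (vle_refl _)).1. Qed.

Lemma vmeet_ler x y : vle (vmeet x y) y.
Proof. exact: ((vmeetP x y _).1 (vle_refl _)).2. Qed.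

Lemma vmeet_le2 x y x' y' : vle x x' -> vle y y' ->
  vle (vmeet x y) (vmeet x' y').
Proof.
move=> xx' yy'; apply/vmeetP; split.
  exact: vle_trans (vmeet_lel x y) xx'.
exact: vle_trans (vmeet_ler x y) yy'.
Qed.

Lemma vmeetC x y : vmeet x y = vmeet y x.
Proof.
by apply: vle_anti; apply/vmeetP; split;
  [exact: vmeet_ler|exact: vmeet_lel|exact: vmeet_ler|exact: vmeet_lel].
Qed.

Lemma vleD2r z x y : vle x y -> vle (x + z) (y + z).
Proof. by rewrite ![_ + z]addrC; exact: vleD2l. Qed.

Lemma vleD x y x' y' : vle x x' -> vle y y' -> vle (x + y) (x' + y').
Proof. by move=> /(@vleD2r y) xx' /(@vleD2l _ _ x'); exact: vle_trans. Qed.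

Lemma vle_addl x y : vle 0 x -> vle y (x + y).
Proof. by move=> /(@vleD2r y); rewrite add0r. Qed.

Lemma vle_addr x y : vle 0 x -> vle y (y + x).
Proof. by rewrite addrC; exact: vle_addl. Qed.

Lemma vle_subl_addl x y z : vle (- x + y) z -> vle y (x + z).
Proof. by move=> /(@vleD2l _ _ x); rewrite addNKr. Qed.

Lemma vle_addl_subl x y z : vle y (x + z) -> vle (- x + y) z.
Proof. by move=> /(@vleD2l _ _ (- x)); rewrite addKr. Qed.

(** The left side [w] lies below each of [x + y], [z + y], [x + z] and [z + z], and translations
    commute with meets. *)
Lemma vmeet_leD x y z : vle 0 x -> vle 0 y -> vle 0 z ->
  vle (vmeet (x + y) z) (vmeet x z + vmeet y z).
Proof.
move=> x0 y0 z0; set w := vmeet (x + y) z.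
have wxy : vle w (x + y) by exact: vmeet_lel.
have wz : vle w z by exact: vmeet_ler.
have H a : vle w (x + a) -> vle w (z + a) -> vle w (vmeet x z + a).
  rewrite ![_ + a]addrC => xa za; apply: vle_subl_addl.
  by apply/vmeetP; split; apply: vle_addl_subl.
apply: vle_subl_addl; apply/vmeetP; split; apply: vle_addl_subl; apply: H => //.
- exact: vle_trans wz (vle_addr _ y0).
- exact: vle_trans wz (vle_addl _ x0).
- exact: vle_trans wz (vle_addl _ z0).
Qed.

Lemma vabs_ge x : vle x (vabs x).
Proof. exact: ((vjoinP x (- x) _).1 (vle_refl _)).1. Qed.

Lemma vabs_geN x : vle (- x) (vabs x).
Proof. exact: ((vjoinP x (- x) _).1 (vle_refl _)).2. Qed.

(** The sum of [x <= |x|] and [- x <= |x|] is [0 <= 2 |x|]. *)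
Lemma vabs_ge0 x : vle 0 (vabs x).
Proof.
have := vleD (vabs_ge x) (vabs_geN x); rewrite subrr -mulr2n => H.
have h : 0 <= 2^-1 :> R by rewrite invr_ge0.
have := vleZ2l _ _ _ h H; rewrite scaler0 -(scaler_nat 2 (vabs x)).
by rewrite scalerA mulVf ?pnatr_eq0// scale1r.
Qed.

Lemma vabs_le x y : vle x y -> vle (- x) y -> vle (vabs x) y.
Proof. by move=> xy Nxy; apply/vjoinP. Qed.

Lemma vabsD x y : vle (vabs (x + y)) (vabs x + vabs y).
Proof.
apply: vabs_le; first exact: vleD (vabs_ge x) (vabs_ge y).
by rewrite opprD; exact: vleD (vabs_geN x) (vabs_geN y).
Qed.

Lemma vabsN x : vabs (- x) = vabs x.
Proof.
apply: vle_anti; apply: vabs_le; rewrite ?opprK.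
- exact: vabs_geN.
- exact: vabs_ge.
- by rewrite -{1}[x]opprK; exact: vabs_geN.
- exact: vabs_ge.
Qed.

Lemma ger0_vabs x : vle 0 x -> vabs x = x.
Proof.
move=> x0; apply: vle_anti; last exact: vabs_ge.
apply: vabs_le; first exact: vle_refl.
apply: vle_trans (x0); rewrite -[X in vle X 0]addr0.
by apply: vle_addl_subl; rewrite addr0.
Qed.

Lemma vmeet_vabs_ge0 x y : vle 0 (vmeet (vabs x) (vabs y)).
Proof. by apply/vmeetP; split; exact: vabs_ge0. Qed.

Lemma vdisjoint_le0 x y : vle (vmeet (vabs x) (vabs y)) 0 -> vdisjoint x y.
Proof. by move=> xy; apply: vle_anti => //; exact: vmeet_vabs_ge0. Qed.

Lemma vdisjointC x y : vdisjoint x y -> vdisjoint y x.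
Proof. by rewrite /vdisjoint vmeetC. Qed.

Lemma vdisjoint0 x : vdisjoint 0 x.
Proof.
by apply: vdisjoint_le0; rewrite ger0_vabs; [exact: vmeet_lel|exact: vle_refl].
Qed.

Lemma vdisjointN x y : vdisjoint x y -> vdisjoint (- x) y.
Proof. by rewrite /vdisjoint vabsN. Qed.

Lemma vdisjointD x y z : vdisjoint x z -> vdisjoint y z -> vdisjoint (x + y) z.
Proof.
move=> xz yz; apply: vdisjoint_le0.
apply: vle_trans (vmeet_le2 (vabsD x y) (vle_refl _)) _.
have := vmeet_leD (vabs_ge0 x) (vabs_ge0 y) (vabs_ge0 z).
by rewrite xz yz addr0.
Qed.

Lemma vdisjointB x y z : vdisjoint x z -> vdisjoint y z -> vdisjoint (x - y) z.
Proof. by move=> xz /vdisjointN; exact: vdisjointD. Qed.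

Lemma vdisjoint_sum (I : Type) (r : seq I) (P : pred I) (f : I -> V) z :
  (forall i, P i -> vdisjoint (f i) z) -> vdisjoint (\sum_(i <- r | P i) f i) z.
Proof.
move=> fz; elim/big_ind : _ => //; first exact: vdisjoint0.
by move=> x y; exact: vdisjointD.
Qed.

(** In [|x| <= |x + y| + |y|], taking the meet with [|x|] removes [|y|]. *)
Lemma vdisjoint_vabs_leD x y : vdisjoint x y -> vle (vabs x) (vabs (x + y)).
Proof.
move=> xy.
have H : vle (vabs x) (vabs (x + y) + vabs y).
  by rewrite -{1}[x](addrK y) -(vabsN y); exact: vabsD.
have := vmeet_leD (vabs_ge0 (x + y)) (vabs_ge0 y) (vabs_ge0 x).
rewrite (vmeetC (vabs y)) xy addr0 => {}xy.
apply: vle_trans (vmeet_lel _ (vabs x)); apply: vle_trans xy.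
by apply/vmeetP; split => //; exact: vle_refl.
Qed.

End vector_lattice.

Section banach_lattice.
Context (R : realType).

Lemma norm_vabs (E : banachLatticeType R) (u : E) : `|vabs u| = `|u|.
Proof.
have uu : vabs (vabs u) = vabs u by apply: ger0_vabs; exact: vabs_ge0.
by apply/le_anti/andP; split; apply: ler_norm_vabs; rewrite uu; exact: vle_refl.
Qed.

(** Disjointness is a closed condition: when [w] and [z] are disjoint, the meet of [|u|] and [|v|]
    is at most [|u - w| + |v - z|]. *)
Lemma vdisjoint_approx (E : banachLatticeType R) (u v : E) :
  (forall e : R, 0 < e ->
     exists w z, [/\ `|u - w| <= e, `|v - z| <= e & vdisjoint w z]) ->
  vdisjoint u v.
Proof.
move=> uv; apply/eqP; rewrite -normr_le0; apply/ler_addgt0Pl => e e0.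
have e20 : 0 < e / 2 by rewrite divr_gt0.
rewrite addr0; have [w [z [uw vz wz]]] := uv _ e20.
apply: le_trans (_ : `|vabs (u - w) + vabs (v - z)| <= _); last first.
  by rewrite (le_trans (ler_normD _ _))// !norm_vabs (splitr e) lerD.
apply: ler_norm_vabs; rewrite (ger0_vabs (vmeet_vabs_ge0 u v)).
apply: vle_trans (vabs_ge _).
have vabsB (a b : E) : vle (vabs a) (vabs (a - b) + vabs b).
  by rewrite -{1}[a](subrK b); exact: vabsD.
apply: vle_trans (vmeet_le2 (vabsB u w) (vle_refl _)) _.
apply: vle_trans (vmeet_leD _ _ _) _; try exact: vabs_ge0.
apply: vleD (vmeet_lel _ _) _.
rewrite vmeetC; apply: vle_trans (vmeet_le2 (vabsB v z) (vle_refl _)) _.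
apply: vle_trans (vmeet_leD _ _ _) _; try exact: vabs_ge0.
by rewrite [vmeet (vabs z) _]vmeetC wz addr0; exact: vmeet_lel.
Qed.

(* The sum [f] of the [u k] satisfies [u k _|_ f - u k], hence
   [`|T (u k)| <= `|T f|] for all [k]. *)
Lemma disjoint_series_bounded (E F : banachLatticeType R) (T : {linear E -> F})
    (u : nat -> E) :
  disjointness_preserving T ->
  (forall i j, i != j -> vdisjoint (u i) (u j)) ->
  (forall k, `|u k| <= 2^-1 ^+ k) ->
  exists M, forall k, `|T (u k)| <= M.
Proof.
move=> Tdp udisj ule.
have cu : cvgn (series u).
  apply: normed_cvg.
  apply: (@series_le_cvg _ _ (geometric 1 2^-1)) => [k|k|k|].
  - exact: normr_ge0.
  - by rewrite /geometric/= mul1r exprn_ge0// invr_ge0.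
  - by rewrite /geometric/= mul1r; exact: ule.
  - by apply: is_cvg_geometric_series; rewrite ger0_norm; lra.
pose f := limn (series u).
exists `|T f| => k; apply: ler_norm_vabs.
have <- : T (u k) + T (f - u k) = T f by rewrite linearB addrC subrK.
apply: vdisjoint_vabs_leD.
apply: (Tdp); apply: vdisjointC; apply: vdisjoint_approx => e e0.
have /cvgrPdist_le/(_ e e0) [N _ fN] : series u @ \oo --> f by [].
(* The index exceeds [k], so that [u k] is a term of the partial sum and can be taken out of it. *)
have := fN (maxn N k.+1) (leq_maxl _ _); set m := maxn _ _ => fm.
exists (series u m - u k), (u k); split.
- by rewrite opprB addrA subrK.
- by rewrite subrr normr0 ltW.
rewrite /series/= big_mkord (bigD1 (Ordinal (leq_maxr N k.+1)))//= addrC addrK.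
by apply: vdisjoint_sum => i ik; exact: udisj.
Qed.

End banach_lattice.

(** * Bounded operators *)

Lemma exists_linear (R : pzRingType) (U V : lmodType R) (f : U -> V) :
  (forall a u v, f (a *: u + v) = a *: f u + f v) ->
  exists g : {linear U -> V}, forall u, g u = f u.
Proof.
move=> lf.
by exists (HB.pack f (GRing.isLinear.Build R U V *:%R f lf) : {linear U -> V}).
Qed.

Section bounded_on.
Context (R : realType).
Implicit Types E F : normedModType R.

(** [A] is any set, since the gliding hump argument works with sets known only to be stable under
    scaling. The sign of [C] is free; [bounded_on_gt0] makes it positive. *)
Definition bounded_on E F (T : E -> F) (A : set E) :=
  exists C, forall f, A f -> `|T f| <= C * `|f|.

Lemma bounded_on_sub E F (T : E -> F) (A B : set E) :
  A `<=` B -> bounded_on T B -> bounded_on T A.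
Proof. by move=> AB [C TC]; exists C => f /AB; exact: TC. Qed.

Lemma bounded_on_gt0 E F (T : E -> F) (A : set E) : bounded_on T A ->
  exists2 C, 0 < C & forall f, A f -> `|T f| <= C * `|f|.
Proof.
move=> [C TC]; exists (`|C| + 1) => [|f Af]; first by rewrite ltr_wpDl.
apply: le_trans (TC f Af) _; rewrite ler_wpM2r// (le_trans (ler_norm C))//.
by rewrite lerDl.
Qed.

Lemma within_continuous_bounded_on E F (T : {linear E -> F}) (A : set E) :
  A 0 -> (forall a f, A f -> A (a *: f)) ->
  {within A, continuous T} -> bounded_on T A.
Proof.
move=> A0 AZ /subspace_continuousP/(_ 0 A0) cT.
have : T f @[f --> within A (nbhs 0)] --> T 0 by exact: cT.
rewrite linear0 => /cvgr0Pnorm_lt/(_ 1 ltr01); rewrite near_withinE.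
move=> /nbhs_norm0P[d/= d0 Td].
exists (2 / d) => f Af; have [->|f0] := eqVneq f 0.
  by rewrite linear0 !normr0 mulr0.
have nf : 0 < `|f| by rewrite normr_gt0.
(* Half of [d], because [T] is controlled only strictly inside the ball of radius [d]. *)
pose a := d / 2 / `|f|; have a0 : 0 < a by rewrite !divr_gt0.
have /Td/(_ (AZ a f Af)) : `|a *: f| < d.
  rewrite normrZ gtr0_norm// /a divfK ?gt_eqF//; lra.
rewrite linearZ/= normrZ gtr0_norm// /a => /ltW.
by rewrite -ler_pdivlMl// mulr1 !invfM !invrK [d^-1 * _]mulrC.
Qed.

Lemma bounded_on_within_continuous E F (T : {linear E -> F}) (A : set E) :
  (forall f g, A f -> A g -> A (f - g)) ->
  bounded_on T A -> {within A, continuous T}.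
Proof.
move=> AB /bounded_on_gt0[C C0 TC]; apply/subspace_continuousP => f Af.
apply/cvgrPdist_lt => e e0; rewrite near_withinE.
have /cvgrPdist_lt/(_ (e / C)) : g @[g --> f] --> f by exact: cvg_id.
rewrite divr_gt0// => /(_ isT); apply: filterS => g fg Ag.
rewrite -linearB (le_lt_trans (TC _ (AB _ _ Af Ag)))//.
by rewrite mulrC -ltr_pdivlMr.
Qed.

Lemma continuous_bounded_on E F (T : {linear E -> F}) :
  continuous T <-> bounded_on T setT.
Proof.
split=> [cT|bT].
  by apply: within_continuous_bounded_on => //; exact: continuous_subspaceT.
apply/continuous_subspace_setT; exact: bounded_on_within_continuous.
Qed.

(** Some [f] in [A] is stretched by more than [|M| / e]; rescaling it to norm [e] does it. This
    supplies the humps. *)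
Lemma unbounded_on_small E F (T : {linear E -> F}) (A : set E) :
  (forall a f, A f -> A (a *: f)) -> ~ bounded_on T A ->
  forall e M : R, 0 < e -> exists f, [/\ A f, `|f| <= e & M < `|T f|].
Proof.
move=> AZ nbT e M e0.
have [f Af Tf] : exists2 f, A f & `|M| / e * `|f| < `|T f|.
  apply: contrapT => H; apply: nbT; exists (`|M| / e) => f Af.
  by rewrite leNgt; apply/negP => Tf; apply: H; exists f.
have f0 : 0 < `|f|.
  rewrite normr_gt0; apply: contraTneq Tf => ->.
  by rewrite linear0 !normr0 mulr0 ltxx.
have a0 : 0 < e / `|f| by rewrite divr_gt0.
exists ((e / `|f|) *: f); split; first exact: AZ.
  by rewrite normrZ gtr0_norm// divfK ?gt_eqF.
rewrite linearZ/= normrZ gtr0_norm// (le_lt_trans (ler_norm M))//.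
move: Tf; rewrite mulrAC ltr_pdivrMr// => Tf.
by rewrite mulrAC ltr_pdivlMr// [e * _]mulrC.
Qed.

(** The value at [f] is the limit of [T h] as [h] tends to [f] inside [L], a proper filter by
    density. The estimate [|v - T h| <= C |f - h|] for all [h] in [L] is all that is kept of this
    limit: it yields linearity, boundedness and agreement with [T]. *)
Lemma bounded_on_extend E (F : completeNormedModType R) (T : {linear E -> F})
    (L : set E) :
  (forall a f g, L f -> L g -> L (a *: f + g)) ->
  (forall f (e : R), 0 < e -> exists2 h, L h & `|f - h| <= e) ->
  bounded_on T L ->
  exists2 S : {linear E -> F}, continuous S & forall h, L h -> S h = T h.
Proof.
move=> LDZ Ld /bounded_on_gt0[C C0 TC].
have LB f g : L f -> L g -> L (f - g).
  by move=> Lf Lg; rewrite addrC -scaleN1r; exact: LDZ.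
have TCB h h' : L h -> L h' -> `|T h - T h'| <= C * `|h - h'|.
  by move=> Lh Lh'; rewrite -linearB; exact/TC/LB.
have ex_lim f : exists v, forall h, L h -> `|v - T h| <= C * `|f - h|.
  pose G := T @ within L (nbhs f).
  have near_f e : 0 < e ->
      \forall h \near within L (nbhs f), L h /\ `|f - h| < e.
    move=> e0; rewrite near_withinE.
    have /cvgrPdist_lt/(_ e e0) : g @[g --> f] --> f by exact: cvg_id.
    by apply: filterS => h fh Lh; split.
  have Gproper : ProperFilter (within L (nbhs f)).
    apply: Build_ProperFilter_ex => P /nbhs_normP[e/= e0 eP].
    have [|h Lh fh] := Ld f (e / 2); first by rewrite divr_gt0.
    exists h; apply: (eP h) => //=; apply: le_lt_trans fh _; lra.
  have /cauchy_cvgP : cauchy G.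
    apply: cauchy_exP => e e0.
    (* Two points of [L] at this distance from [f] have images within [e] of each other. *)
    have d0 : 0 < e / (2 * C) by rewrite divr_gt0// mulr_gt0.
    have [h Lh fh] := Ld f _ d0; exists (T h); rewrite /G nbhs_simpl/=.
    apply: filterS (near_f _ d0) => h' [Lh' fh']; rewrite -ball_normE/=.
    apply: le_lt_trans (TCB _ _ Lh Lh') _.
    have hh' : `|h - h'| < e / (2 * C) + e / (2 * C).
      rewrite -(subrK f h) -addrA; apply: le_lt_trans (ler_normD _ _) _.
      by rewrite distrC ler_ltD.
    rewrite mulrC -ltr_pdivlMr//; apply: lt_le_trans hh' _.
    by rewrite invfM mulrA -mulrDl -splitr.
  move=> /cvg_ex[v Gv]; exists v => h Lh; apply/ler_addgt0Pl => e e0.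
  have e20 : 0 < e / 2 by rewrite divr_gt0.
  have d0 : 0 < e / 2 / C by rewrite divr_gt0.
  have /cvgrPdist_lt/(_ _ e20) := Gv; move=> /= Gve.
  have [h' [vh' [Lh' fh']]] := filter_ex (filterI Gve (near_f _ d0)).
  rewrite -(subrK (T h') v) -addrA; apply: le_trans (ler_normD _ _) _.
  have : C * `|h' - h| <= e / 2 + C * `|f - h|.
    rewrite -ler_pdivlMl// mulrDr mulKf ?gt_eqF// [C^-1 * _]mulrC.
    rewrite -(subrK f h') -addrA; apply: le_trans (ler_normD _ _) _.
    by rewrite lerD2r distrC ltW.
  have := TCB _ _ Lh' Lh; move: vh'; rewrite /=; lra.
have [S SP] := choice ex_lim.
have lS a f g : S (a *: f + g) = a *: S f + S g.
  apply/eqP; rewrite -subr_eq0 -normr_le0; apply/ler_addgt0Pl => e e0.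
  (* With approximations of [f] and [g] up to [e / b], the two error terms below are each at most
     [C (|a| + 1) e / b = e / 2]. *)
  rewrite addr0; set b := 2 * C * (`|a| + 1).
  have b0 : 0 < b by rewrite !mulr_gt0// ltr_wpDl.
  have d0 : 0 < e / b by rewrite divr_gt0.
  have [h Lh fh] := Ld f _ d0; have [k Lk gk] := Ld g _ d0.
  have -> : S (a *: f + g) - (a *: S f + S g) =
      (S (a *: f + g) - T (a *: h + k)) - (a *: (S f - T h) + (S g - T k)).
    rewrite linearP scalerBr addrACA -opprD opprB addrA subrK//.
  have fgd : `|a *: f + g - (a *: h + k)| <= (`|a| + 1) * (e / b).
    rewrite opprD addrACA -scalerBr (le_trans (ler_normD _ _))// normrZ.
    by rewrite mulrDl mul1r lerD// ler_wpM2l.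
  apply: le_trans (ler_normB _ _) _.
  have := SP (a *: f + g) _ (LDZ a _ _ Lh Lk).
  have : `|a *: (S f - T h) + (S g - T k)| <= (`|a| + 1) * (C * (e / b)).
    rewrite (le_trans (ler_normD _ _))// normrZ mulrDl mul1r lerD//.
      by rewrite ler_wpM2l// (le_trans (SP f _ Lh))// ler_wpM2l// ltW.
    by rewrite (le_trans (SP g _ Lk))// ler_wpM2l// ltW.
  have : C * `|a *: f + g - (a *: h + k)| <= C * ((`|a| + 1) * (e / b)).
    by rewrite ler_wpM2l// ltW.
  have : C * ((`|a| + 1) * (e / b)) = e / 2.
    by rewrite mulrA /b; field; rewrite !gt_eqF// ltr_wpDl.
  rewrite [(`|a| + 1) * (C * _)]mulrCA; lra.
have [S' S'E] := exists_linear lS; exists S' => [|h Lh]; last first.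
  rewrite S'E; apply/eqP; rewrite -subr_eq0 -normr_le0 (le_trans (SP h h Lh))//.
  by rewrite subrr normr0 mulr0.
apply/continuous_bounded_on; exists C => f _; rewrite S'E.
(* Density makes [L] nonempty, so [0 = h - h] is in [L], and the estimate at [0] is the bound. *)
have [h Lh _] := Ld f 1 ltr01; have := SP f (h - h) (LB h h Lh Lh).
by rewrite subrr linear0 !subr0.
Qed.

End bounded_on.

(** If [Q setT] failed, the complements of the sets satisfying [Q] would form a proper filter. It
    would cluster at some [p], yet contain the complement of a neighborhood of [p]. *)
Lemma compact_local_to_global (X : topologicalType) (Q : set X -> Prop) :
  compact [set: X] ->
  Q set0 -> (forall A B, Q A -> Q B -> Q (A `|` B)) ->
  (forall A B, A `<=` B -> Q B -> Q A) ->
  (forall x : X, exists2 U, nbhs x U & Q U) -> Q setT.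
Proof.
move=> cX Q0 QU QS Qloc; apply: contrapT => nQ.
pose G : set_system X := [set A | Q (~` A)].
have GF : ProperFilter G.
  apply: Build_ProperFilter; first by rewrite /G/= setC0.
  split=> [|A B|A B AB]; rewrite /G/=.
  - by rewrite setCT.
  - by rewrite setCI; exact: QU.
  - by apply: QS; exact: subsetC.
have [|p [_ Gp]] := cX G GF; first exact: filterT.
have [U pU QUU] := Qloc p.
by have [|y []] := Gp (~` U) U _ pU; first by rewrite /G/= setCK.
Qed.

(** * Continuous functions on a compact Hausdorff space *)

Section Cfun_theory.
Context (R : realType) (X : compactHausdorffType).
Local Notation C := (Cfun X R).

Lemma Cfun_norm_ub (f : C) x : `|f x| <= `|f|.
Proof. exact: sup_norm_ub. Qed.

Lemma Cfun_norm_le (f : C) (M : R) :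
  0 <= M -> (forall x, `|f x| <= M) -> `|f| <= M.
Proof. exact: sup_norm_le. Qed.

Lemma Cfun_vdisjointP (f g : C) :
  vdisjoint f g <-> forall y, f y = 0 \/ g y = 0.
Proof.
have H y : vmeet (vabs f) (vabs g) y = Num.min `|f y| `|g y|.
  by rewrite Cfun_meetE !Cfun_vabsE.
split=> [fg y|fg].
  have := H y; rewrite fg Cfun0E minEle.
  by case: ifP => _ /esym/normr0_eq0; [left|right].
apply: Cfun_eqP => y; rewrite H Cfun0E; have [-> | ->] := fg y.
  by rewrite normr0; apply/min_idPl.
by rewrite normr0; apply/min_idPr.
Qed.

Lemma Cfun_sumE (I : Type) (r : seq I) (P : pred I) (f : I -> C) y :
  (\sum_(i <- r | P i) f i) y = \sum_(i <- r | P i) f i y.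
Proof. by elim/big_rec2 : _ => // i _ g _ <-. Qed.

Lemma cmul_subproof (g f : C) : continuous (fun x => g x * f x).
Proof. by move=> x; apply: continuousM; exact: Cfun_cts. Qed.

Definition cmul (g f : C) : C := mkCfun (@cmul_subproof g f).

Lemma cmulE g f x : cmul g f x = g x * f x. Proof. by []. Qed.

Lemma cmul_linear g a (f h : C) :
  cmul g (a *: f + h) = a *: cmul g f + cmul g h.
Proof.
by apply: Cfun_eqP => y; rewrite !(cmulE, CfunDE, CfunZE) mulrDr mulrCA.
Qed.

Lemma cmul_norm g f : `|cmul g f| <= `|g| * `|f|.
Proof.
apply: Cfun_norm_le => [|y]; first exact: mulr_ge0.
by rewrite cmulE normrM ler_pM// Cfun_norm_ub.
Qed.

Lemma cone_subproof : continuous (fun _ : X => 1 : R).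
Proof. exact: cst_continuous. Qed.

Definition cone : C := mkCfun cone_subproof.

Lemma coneE x : cone x = 1. Proof. by []. Qed.

Lemma Cfun_near_neq0 (f : C) x : f x <> 0 -> \forall y \near x, f y <> 0.
Proof.
move=> fx; have /cvgr_neq0 : f y @[y --> x] --> f x by exact: (@Cfun_cts X R f).
by move=> /(_ (introN eqP fx)); apply: filterS => y /eqP.
Qed.

Lemma separation (x y : X) : x <> y ->
  exists U V, [/\ open_nbhs x U, open_nbhs y V & forall z, U z -> V z -> False].
Proof.
move=> /eqP xy; have := @hausdorff_sep X; rewrite open_hausdorff.
move=> /(_ x y xy)[[U V]/= [/set_mem Ux /set_mem Vy] [oU oV /eqP UV]].
by exists U, V; split=> // z Uz Vz; have : (U `&` V) z by []; rewrite UV.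
Qed.

(** A Urysohn function [f] equals 1 only at [x] itself; the minimum of [2 f] and 1 equals 1 wherever
    [f > 1/2], hence near [x]. *)
Lemma bump (x : X) (U : set X) : nbhs x U -> exists e : C,
  [/\ forall y, 0 <= e y <= 1, \forall y \near x, e y = 1
    & forall y, e y <> 0 -> U y].
Proof.
move=> xU; have nX : normal_space X.
  by apply: compact_normal; [exact: hausdorff_sep|exact: compact_space].
have [] := @urysohn_ext_itv X R nX (~` U^°) [set x] 0 1.
- by apply: open_closedC; exact: open_interior.
- apply: accessible_closed_set1; apply: hausdorff_accessible.
  exact: hausdorff_sep.
- by apply/seteqP; split=> // y [/= Uy yx]; apply: Uy; rewrite yx.
- exact: ltr01.
move=> f [cf f0 f1 f01].
have ce : continuous (fun y => Num.min (f y + f y) 1 : R).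
  move=> y; apply: (@continuous_min R X (fun y => f y + f y) (fun=> 1)).
    by apply: continuousD; exact: cf.
  exact: cst_continuous.
exists (mkCfun ce); split=> [y||y].
- have : `[0, 1]%classic (f y) by apply: f01; exists y.
  rewrite /= in_itv/= => /andP[fy0 _].
  by rewrite ge_min lexx orbT le_min ler01 addr_ge0.
- have fx : f x = 1 by apply: f1; exists x.
  have : \forall y \near x, 2^-1 < f y.
    have /cvgr_gt : f y @[y --> x] --> f x by exact: cf.
    by apply; rewrite fx; lra.
  apply: filterS => y fy; change (Num.min (f y + f y) 1 = 1).
  by apply/min_idPr; lra.
- change (Num.min (f y + f y) 1 <> 0 -> U y) => fy.
  apply: interior_subset; apply: contrapT => Uy; apply: fy.
  have -> : f y = 0 by apply: f0; exists y.
  by rewrite addr0; apply/min_idPl.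
Qed.

End Cfun_theory.

(** * Singularity points *)

Section support.
Context (R : realType) (X : compactHausdorffType).
Local Notation C := (Cfun X R).
Implicit Types (F : banachLatticeType R) (U W : set X) (f g : C).

Lemma K_Z U a f : K_ U f -> K_ U (a *: f).
Proof. by move=> Uf y Uy; rewrite CfunZE Uf// mulr0. Qed.

Lemma K_B U f g : K_ U f -> K_ U g -> K_ U (f - g).
Proof. by move=> Uf Ug y Uy; rewrite CfunDE CfunNE Uf// Ug// subrr. Qed.

Lemma K_nz U f : (forall y, f y <> 0 -> U y) -> K_ U f.
Proof. by move=> Uf y Uy; apply: contrapT => /Uf. Qed.

Lemma K_cmull U f g : K_ U f -> K_ U (cmul f g).
Proof. by move=> Uf y Uy; rewrite cmulE Uf// mul0r. Qed.

Lemma K_cmulr U f g : K_ U g -> K_ U (cmul f g).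
Proof. by move=> Ug y Uy; rewrite cmulE Ug// mulr0. Qed.

Lemma K_sub U W f : U `<=` W -> K_ U f -> K_ W f.
Proof. by move=> UW Uf y Wy; apply: Uf => /UW. Qed.

Lemma J_near (x : X) f : J_ x f <-> \forall y \near x, f y = 0.
Proof.
split=> [[U xU Uf]|].
  by apply: filterS Uf _; apply: open_nbhs_nbhs.
move=> fx; have : nbhs x [set y | f y = 0] by [].
by rewrite topology_structure.nbhsE => -[U xU Uf]; exists U.
Qed.

Lemma singularity_pointP F (T : {linear C -> F}) (x : X) :
  singularity_point T x <-> forall U, nbhs x U -> ~ bounded_on T (K_ U).
Proof.
split=> [Tx U|Tx U xU cT].
  rewrite topology_structure.nbhsE => -[V xV VU] bT; apply: (Tx V xV).
  apply: bounded_on_within_continuous; first exact: K_B.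
  by apply: bounded_on_sub bT => f; exact: K_sub.
apply: (Tx U (open_nbhs_nbhs xU)).
by apply: within_continuous_bounded_on => // a f; exact: K_Z.
Qed.

Lemma not_singularity_point F (T : {linear C -> F}) (x : X) :
  ~ singularity_point T x -> exists2 U, nbhs x U & bounded_on T (K_ U).
Proof.
move=> Tx; apply: contrapT => H; apply: Tx; apply/singularity_pointP => U xU bT.
by apply: H; exists U.
Qed.

(** A substitute for partitions of unity: weights [p >= 0] for which [f] maps boundedly to [T (p f)]
    can be added, so compactness gives one that is positive everywhere. Then
    [T f = T (p (p^-1 f))]. *)
Lemma locally_bounded_continuous F (T : {linear C -> F}) :
  (forall x : X, exists2 U, nbhs x U & bounded_on T (K_ U)) ->
  bounded_on T setT.
Proof.
move=> Tloc.
pose Q A := exists p : C, [/\ forall y, 0 <= p y, forall y, A y -> 0 < p y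
  & bounded_on (fun f => T (cmul p f)) setT].
have [||||p [_ p0 [c Tp]]] := @compact_local_to_global X Q compact_space.
- exists 0; split=> //; exists 0 => f _.
  rewrite mul0r (_ : cmul 0 f = 0) ?linear0 ?normr0//.
  by apply: Cfun_eqP => y; rewrite cmulE mul0r.
- move=> A B [p [p0 pA [c Tp]]] [q [q0 qB [d Tq]]]; exists (p + q).
  split=> [y|y|]; rewrite ?CfunDE.
  + exact: addr_ge0.
  + by case=> [/pA py|/qB qy]; [exact: ltr_pwDl|exact: ltr_wpDl].
  + exists (c + d) => f _.
    have -> : cmul (p + q) f = cmul p f + cmul q f.
      by apply: Cfun_eqP => y; rewrite !(cmulE, CfunDE) mulrDl.
    by rewrite linearD (le_trans (ler_normD _ _))// mulrDl lerD ?Tp ?Tq.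
- move=> A B AB [p [p0 pB Tp]]; exists p; split=> // y /AB; exact: pB.
- move=> x; have [U xU /bounded_on_gt0[c c0 Tc]] := Tloc x.
  have [e [e01 e1 eU]] := bump R xU.
  exists [set y | e y = 1]; first exact: e1.
  exists e; split=> [y|y/= ->//|]; first by case/andP: (e01 y).
  exists (c * `|e|) => f _; apply: le_trans (Tc _ _) _.
    by apply: K_cmull; exact: K_nz.
  by rewrite -mulrA ler_wpM2l ?cmul_norm// ltW.
have cp : continuous (fun y => (p y)^-1).
  move=> y; apply: continuousV; last exact: Cfun_cts.
  by rewrite gt_eqF ?p0.
exists (`|c| * `|mkCfun cp|) => f _.
have {1}-> : f = cmul p (cmul (mkCfun cp) f).
  apply: Cfun_eqP => y; rewrite !cmulE.
  by change (f y = p y * ((p y)^-1 * f y)); rewrite mulVKf// gt_eqF ?p0.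
apply: le_trans (Tp _ I) _; rewrite -mulrA.
apply: le_trans (ler_wpM2r (normr_ge0 _) (ler_norm c)) _.
by rewrite ler_wpM2l ?cmul_norm.
Qed.

(* Gliding hump: otherwise one picks inductively sets [W k] with [P (W k)] and
   small functions [u k] with large image under [T], supported in [W k] and
   vanishing on [W k.+1], hence pairwise disjoint. *)
Lemma bounded_on_gliding F (T : {linear C -> F}) (P : set X -> Prop) W0 :
  disjointness_preserving T -> P W0 ->
  exists2 W, P W & bounded_on T [set f | K_ W f /\
    exists W', [/\ P W', W' `<=` W & forall y, W' y -> f y = 0]].
Proof.
move=> Tdp PW0; apply: contrapT => nb.
have step (kW : nat * set X) : exists fW : C * set X, P kW.2 ->
    [/\ P fW.2, fW.2 `<=` kW.2, K_ kW.2 fW.1,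
        forall y, fW.2 y -> fW.1 y = 0
      & `|fW.1| <= 2^-1 ^+ kW.1 /\ kW.1%:R < `|T fW.1|].
  (* [(0, W)] is a dummy value, never reached because every [W k] satisfies [P]. *)
  case: kW => k W /=; have [PW|nPW] := pselect (P W); last by exists (0, W).
  pose A : set C := [set f | K_ W f /\ exists W', [/\ P W', W' `<=` W &
    forall y, W' y -> f y = 0]].
  have nA : ~ bounded_on T A by move=> bA; apply: nb; exists W.
  have [||f [[Wf [W' [PW' W'W fW']]] fk Tf]] :=
      @unbounded_on_small _ _ _ T A _ nA (2^-1 ^+ k) k%:R.
  - move=> a f [Wf [W' [PW' W'W fW']]]; split; first exact: K_Z.
    by exists W'; split=> // y /fW' fy; rewrite CfunZE fy mulr0.
  - by rewrite exprn_gt0// invr_gt0.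
  by exists (f, W').
have [next nextP] := choice step.
pose W := fix W k := if k is k'.+1 then (next (k', W k')).2 else W0.
pose u k := (next (k, W k)).1.
have PW k : P (W k).
  by elim: k => // k IHk; have [] := nextP (k, W k) IHk.
have WS k : W k.+1 `<=` W k by have [] := nextP (k, W k) (PW k).
have Wle i j : (i <= j)%N -> W j `<=` W i.
  move=> /subnK <-; elim: (j - i)%N => // n IHn.
  exact: subset_trans (WS _) IHn.
have udisj i j : (i < j)%N -> vdisjoint (u i) (u j).
  move=> ij; apply/Cfun_vdisjointP => y.
  have [_ _ _ ui _] := nextP (i, W i) (PW i).
  have [_ _ uj _ _] := nextP (j, W j) (PW j).
  (* Off [W j] the function [u j] vanishes; on it [u i] does, as [W j] lies inside [W i.+1]. *)
  have [Wy|Wy] := pselect (W j y); last by right; exact: uj.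
  by left; apply: ui; exact: (Wle i.+1 j).
have [i j|k|M TM] := @disjoint_series_bounded R _ _ T u Tdp.
- by rewrite neq_ltn => /orP[/udisj//|/udisj/vdisjointC].
- by have [_ _ _ _ []] := nextP (k, W k) (PW k).
(* This [k] exceeds [|M|], against [k < |T (u k)| <= M]. *)
pose k := Num.Def.archi_bound `|M|.
have [_ _ _ _ [_ /= kT]] := nextP (k, W k) (PW k).
have := archi_boundP (normr_ge0 M); have := TM k; have := ler_norm M.
rewrite -/k /u; lra.
Qed.

(** Take the [W] of the gliding hump for the neighborhoods of [p]. If [a] in [W] differs from [p],
    functions supported close enough to [a] vanish near [p], and [T] is bounded on them. *)
Lemma singularity_isolated F (T : {linear C -> F}) (p : X) :
  disjointness_preserving T ->
  exists2 W, nbhs p W & forall a, W a -> singularity_point T a -> a = p.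
Proof.
move=> Tdp; have [|W pW bW] := @bounded_on_gliding F T (nbhs p) setT Tdp.
  exact: filterT.
exists W° => [|a Wa /singularity_pointP Ta]; first exact: nbhs_interior.
apply: contrapT => /separation[U [V [aU pV UV]]].
apply: (Ta (U `&` W)); first by apply: filterI => //; exact: open_nbhs_nbhs.
apply: bounded_on_sub bW => f Uf; split.
  by apply: K_sub Uf => y [].
exists (V `&` W); split; first by apply: filterI => //; exact: open_nbhs_nbhs.
  by move=> y [].
by move=> y [Vy _]; apply: Uf => -[/UV]; exact.
Qed.

Lemma finite_singularity_set F (T : {linear C -> F}) :
  disjointness_preserving T -> finite_set (singularity_set T).
Proof.
move=> Tdp; rewrite -[X in finite_set X]setTI.
apply: (@compact_local_to_global X (fun A => finite_set (A `&` _))).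
- exact: compact_space.
- by rewrite set0I; exact: finite_set0.
- by move=> A B fA fB; rewrite setIUl finite_setU.
- by move=> A B AB; apply: sub_finite_set; exact: setSI.
move=> x; have [W xW Wx] := singularity_isolated x Tdp; exists W => //.
by apply: sub_finite_set (finite_set1 x) => a [/Wx]; exact.
Qed.

End support.

(** * Decomposition *)

Section decomposition.
Context (R : realType) (X : compactHausdorffType) (n : nat) (x : 'I_n -> X).
Hypothesis x_inj : injective x.
Local Notation C := (Cfun X R).
Implicit Types (F : banachLatticeType R) (f g h k : C) (e : 'I_n -> C).

(** * Bumps with disjoint supports around the points [x i] *)

Definition bump_family e (W : 'I_n -> set X) :=
  [/\ forall i y, 0 <= e i y <= 1,
      forall i, \forall y \near x i, e i y = 1,
      forall i y, e i y <> 0 -> W i y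
    & forall i j y, e i y <> 0 -> e j y <> 0 -> i = j].

Lemma bump_family_exists (W : 'I_n -> set X) :
  (forall i, nbhs (x i) (W i)) -> exists e, bump_family e W.
Proof.
move=> xW.
have sep (ij : 'I_n * 'I_n) : exists UV : set X * set X, ij.1 <> ij.2 ->
    [/\ nbhs (x ij.1) UV.1, nbhs (x ij.2) UV.2
      & forall z, UV.1 z -> UV.2 z -> False].
  have [ij12|ij12] := pselect (ij.1 = ij.2); first by exists (set0, set0).
  have [U [V [oU oV UV]]] : exists U V, [/\ open_nbhs (x ij.1) U,
      open_nbhs (x ij.2) V & forall z, U z -> V z -> False].
    by apply: separation => /x_inj.
  by exists (U, V) => _; split=> //; exact: open_nbhs_nbhs.
have [UV UVP] := choice sep.
(* The separations chosen for [(i, j)] and [(j, i)] are unrelated, so [U i] is cut down by both. *)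
pose U i := W i `&`
  [set y | forall j, i <> j -> (UV (i, j)).1 y /\ (UV (j, i)).2 y].
have xU i : nbhs (x i) (U i).
  apply: filterI => //; apply: filter_forall => j.
  have [->|/eqP ij] := eqVneq i j; first by near=> y.
  have [xi _ _] := UVP (i, j) ij.
  have [_ xj _] := UVP (j, i) (fun ji => ij (esym ji)).
  by apply: filterS (filterI xi xj) => y [].
have [e eP] := choice (fun i => bump R (xU i)).
exists e; split=> [i y|i|i y|i j y].
- by have [] := eP i.
- by have [] := eP i.
- by have [_ _ /(_ y) eU] := eP i => /eU[].
have [_ _ /(_ y) eU] := eP i => /eU[_ Ui].
have [_ _ /(_ y) eV] := eP j => /eV[_ Uj].
apply: contrapT => ij; have [_ _ /(_ y)] := UVP (i, j) ij.
by apply; [exact: (Ui j ij).1|exact: (Uj i (fun ji => ij (esym ji))).2].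
Unshelve. all: by end_near. Qed.

Lemma bump_family_sum e W (c : 'I_n -> R) i y : bump_family e W ->
  e i y <> 0 -> \sum_j e j y * c j = e i y * c i.
Proof.
move=> [_ _ _ e0] ei; rewrite (bigD1 i)//= big1 ?addr0// => j ji.
have [->|/eqP ej] := eqVneq (e j y) 0; first by rewrite mul0r.
by rewrite (e0 _ _ _ ej ei) eqxx in ji.
Qed.

Lemma bump_family_near e W i : bump_family e W ->
  \forall y \near x i, e i y = 1 /\ forall j, j != i -> e j y = 0.
Proof.
move=> [_ e1 _ e0]; apply: filterS (e1 i) => y ei; split=> // j ji.
apply: contrapT => ej; move: ji; rewrite (e0 j i y ej) ?eqxx// ei.
by apply/eqP; rewrite oner_eq0.
Qed.

(** * Functions constant near each [x i] *)

Definition locally_constant_at : set C :=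
  [set f | forall i, \forall y \near x i, f y = f (x i)].

Local Notation L := locally_constant_at.

Lemma locally_constant_atDZ a f g : L f -> L g -> L (a *: f + g).
Proof.
move=> Lf Lg i; apply: filterS (filterI (Lf i) (Lg i)) => y [/= fy gy].
by rewrite !CfunDE !CfunZE fy gy.
Qed.

Lemma J_locally_constant_at f : (forall i, J_ (x i) f) -> L f.
Proof.
move=> Jf i; have /J_near fi := Jf i.
by apply: filterS (fi) => y ->; rewrite (nbhs_singleton fi).
Qed.

(** Near [x i] the factor [f] vanishes, and near the other [x j] the factor [e i] does. *)
Lemma J_bump_family_mul e W i f : bump_family e W -> J_ (x i) f ->
  forall j, J_ (x j) (cmul (e i) f).
Proof.
move=> eW /J_near fi j; apply/J_near; have [<-|ij] := eqVneq i j.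
  by apply: filterS fi => y fy; rewrite cmulE fy mulr0.
apply: filterS (bump_family_near j eW) => y [_ /(_ i ij) ei].
by rewrite cmulE ei mul0r.
Qed.

(** Near [x i] the sum reduces to [f (x i)]. Thus [L] is split into functions vanishing near all
    [x i] and the span of the [e j]. *)
Lemma J_bump_family_sub e W f : bump_family e W -> L f ->
  forall i, J_ (x i) (f - \sum_j f (x j) *: e j).
Proof.
move=> eW Lf i; apply/J_near.
apply: filterS (filterI (Lf i) (bump_family_near i eW)) => y [/= fy [ei _]].
have ei0 : e i y <> 0 by rewrite ei; apply/eqP; rewrite oner_eq0.
rewrite CfunDE CfunNE Cfun_sumE fy.
under eq_bigr do rewrite CfunZE mulrC.
by rewrite (bump_family_sum _ eW ei0) ei mul1r subrr.
Qed.

(** [T] and its extension agree on this remainder, so only the pieces [e j * f] contribute to their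
    difference. *)
Lemma J_bump_family_mulB e W f : bump_family e W ->
  forall i, J_ (x i) (f - \sum_j cmul (e j) f).
Proof.
move=> eW i; apply/J_near.
apply: filterS (bump_family_near i eW) => y [ei _].
have ei0 : e i y <> 0 by rewrite ei; apply/eqP; rewrite oner_eq0.
rewrite CfunDE CfunNE Cfun_sumE.
under eq_bigr do rewrite cmulE.
by rewrite (bump_family_sum (fun=> f y) eW ei0) ei mul1r subrr.
Qed.

(** Where [e i] is nonzero, this is the convex combination [(1 - e i) f + e i f (x i)]; elsewhere it
    is [f]. *)
Definition flatten_at e f : C :=
  f + \sum_i cmul (e i) (f (x i) *: cone R X - f).

Lemma flatten_atE e W f y i : bump_family e W -> e i y <> 0 ->
  flatten_at e f y = f y + e i y * (f (x i) - f y).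
Proof.
move=> eW ei; rewrite /flatten_at CfunDE Cfun_sumE.
under eq_bigr do rewrite cmulE CfunDE CfunNE CfunZE coneE mulr1.
by rewrite (bump_family_sum _ eW ei).
Qed.

Lemma flatten_at_id e f y : (forall i, e i y = 0) -> flatten_at e f y = f y.
Proof.
move=> e0; rewrite /flatten_at CfunDE Cfun_sumE big1 ?addr0// => i _.
by rewrite cmulE e0 mul0r.
Qed.

Lemma flatten_at_locally_constant e W f : bump_family e W -> L (flatten_at e f).
Proof.
move=> eW i.
have H : \forall y \near x i, flatten_at e f y = f (x i).
  apply: filterS (bump_family_near i eW) => y [ei _].
  have ei0 : e i y <> 0 by rewrite ei; apply/eqP; rewrite oner_eq0.
  by rewrite (flatten_atE _ eW ei0) ei mul1r addrC subrK.
by apply: filterS (H) => y ->; rewrite (nbhs_singleton H).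
Qed.

Lemma flatten_at_approx e W f (d : R) : bump_family e W -> 0 <= d ->
  (forall i y, W i y -> `|f y - f (x i)| <= d) -> `|f - flatten_at e f| <= d.
Proof.
move=> eW d0 fd; apply: Cfun_norm_le => // y; rewrite CfunDE CfunNE.
have [e0|/existsNP[i ei]] := pselect (forall i, e i y = 0).
  by rewrite flatten_at_id// subrr normr0.
rewrite (flatten_atE _ eW ei) opprD addrA subrr sub0r normrN normrM distrC.
have [/(_ i y)/andP[ei0 ei1] _ /(_ i y ei) Wy _] := eW.
by rewrite ger0_norm// (le_trans _ (fd i y Wy))// ler_piMl.
Qed.

Lemma flatten_at_eq0 e W f y : bump_family e W -> f y = 0 ->
  (forall i, e i y <> 0 -> f (x i) = 0) -> flatten_at e f y = 0.
Proof.
move=> eW fy fx; have [e0|/existsNP[i ei]] := pselect (forall i, e i y = 0).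
  by rewrite flatten_at_id.
by rewrite (flatten_atE _ eW ei) fy fx// subrr mulr0 addr0.
Qed.

(** Both functions are flattened on sets [W i] where a nonzero value at [x i] persists. If [f (x i)]
    is nonzero, [g] vanishes on [W i] and stays zero there; if both vanish at [x i], flattening
    multiplies them by [1 - e i]. In the last clause all zeros of [g] survive, so [k] is disjoint
    from [f] itself. *)
Lemma disjoint_locally_constant_approx f g (d : R) : 0 < d -> vdisjoint f g ->
  exists h k, [/\ L h /\ L k, `|f - h| <= d, `|g - k| <= d, vdisjoint h k
    & (forall i, g (x i) = 0) -> vdisjoint f k].
Proof.
move=> d0 /Cfun_vdisjointP fg.
pose W i := [set y | [/\ `|f y - f (x i)| <= d, `|g y - g (x i)| <= d,
  f (x i) <> 0 -> f y <> 0 & g (x i) <> 0 -> g y <> 0]].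
have near_d (u : C) i : \forall y \near x i, `|u y - u (x i)| <= d.
  have /cvgrPdist_le/(_ d d0) : u y @[y --> x i] --> u (x i).
    exact: (@Cfun_cts X R u).
  by apply: filterS => y; rewrite distrC.
have near_n0 (u : C) i : \forall y \near x i, u (x i) <> 0 -> u y <> 0.
  have [->|/eqP ui] := eqVneq (u (x i)) 0; first by near=> y.
  by apply: filterS (Cfun_near_neq0 ui).
have [|e eW] := @bump_family_exists W.
  move=> i; near=> y; split; near: y;
    [exact: near_d|exact: near_d|exact: near_n0|exact: near_n0].
have [_ _ eWi _] := eW.
have vanish (u v : C) y i : (forall z, u z = 0 \/ v z = 0) -> e i y <> 0 ->
   (u (x i) <> 0 -> u y <> 0) -> u (x i) <> 0 -> flatten_at e v y = 0.
  move=> uv ei ux ui; have vy : v y = 0 by have [/(ux ui)|] := uv y.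
  apply: (flatten_at_eq0 eW vy) => j ej; have [_ _ _ e0] := eW.
  by rewrite (e0 _ _ _ ej ei); have [/ui|] := uv (x i).
exists (flatten_at e f), (flatten_at e g); split.
- by split; exact: flatten_at_locally_constant eW.
- by apply: (flatten_at_approx eW (ltW d0)) => i y [].
- by apply: (flatten_at_approx eW (ltW d0)) => i y [].
- apply/Cfun_vdisjointP => y.
  have [e0|/existsNP[i ei]] := pselect (forall i, e i y = 0).
    by rewrite !flatten_at_id.
  have [_ _ fi gi] := eWi i y ei.
  have gf z : g z = 0 \/ f z = 0 by case: (fg z); [right|left].
  have [fx|/eqP fx] := eqVneq (f (x i)) 0; last first.
    by right; exact: (vanish f g y i).
  have [gx|/eqP gx] := eqVneq (g (x i)) 0; last first.
    by left; exact: (vanish g f y i).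
  rewrite !(flatten_atE _ eW ei) fx gx.
  by have [->|->] := fg y; [left|right]; rewrite subrr mulr0 addr0.
move=> gx; apply/Cfun_vdisjointP => y; have [->|gy] := fg y; [by left|right].
exact: (flatten_at_eq0 eW).
Unshelve. all: by end_near. Qed.

(** * Boundedness of [T] on functions constant near its singularity points *)

Section operator.
Context (F : banachLatticeType R) (T : {linear C -> F}).
Hypothesis T_dp : disjointness_preserving T.

(** Let [W] come from the gliding hump for common neighborhoods of the [x i], and [p], supported in
    [W], equal 1 near them. The gliding hump bounds [T (p f)]. The operator [T ((1 - p) f)] is
    locally bounded: near [x i] it is zero, and elsewhere [T] is locally bounded. *)
Lemma bounded_on_J :
  (forall a, singularity_point T a -> exists i, a = x i) ->
  bounded_on T [set f | forall i, J_ (x i) f].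
Proof.
move=> Tx.
have [|W xW [b Tb]] :=
    @bounded_on_gliding R X F T (fun W => forall i, nbhs (x i) W) setT T_dp.
  by move=> i; exact: filterT.
have [e eW] := @bump_family_exists (fun=> W) xW.
pose p := \sum_i e i.
have pW : K_ W p.
  move=> y Wy; rewrite Cfun_sumE big1// => i _; apply: contrapT.
  by have [_ _ /(_ i y) eWy _] := eW => /eWy.
have p1 i : \forall y \near x i, p y = 1.
  apply: filterS (bump_family_near i eW) => y [ei e0].
  by rewrite Cfun_sumE (bigD1 i)//= big1 ?addr0.
have [T' T'E] : exists T' : {linear C -> F},
    forall f, T' f = T (cmul (cone R X - p) f).
  apply: (@exists_linear R _ _ (fun f => T (cmul (cone R X - p) f))) => a f g.
  by rewrite cmul_linear linearP.
have [c T'c] : bounded_on T' setT.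
  apply: locally_bounded_continuous => y.
  have [/Tx[i ->]|/not_singularity_point[U yU /bounded_on_gt0[c c0 Tc]]] :=
    pselect (singularity_point T y).
    exists [set y | p y = 1]; first exact: p1.
    exists 0 => f Uf; rewrite T'E mul0r (_ : cmul _ f = 0) ?linear0 ?normr0//.
    apply: Cfun_eqP => z; rewrite cmulE CfunDE CfunNE coneE.
    have [->|/eqP pz] := eqVneq (p z) 1; first by rewrite subrr mul0r.
    by rewrite Uf// mulr0.
  exists U => //; exists (c * `|cone R X - p|) => f Uf.
  rewrite T'E (le_trans (Tc _ _))//; first exact: K_cmulr.
  by rewrite -mulrA ler_wpM2l ?cmul_norm// ltW.
exists (`|b| * `|p| + c) => f Jf.
have -> : T f = T (cmul p f) + T' f.
  rewrite T'E -linearD; congr (T _); apply: Cfun_eqP => y.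
  by rewrite CfunDE !cmulE CfunDE CfunNE coneE mulrBl mul1r addrC subrK.
rewrite (le_trans (ler_normD _ _))// mulrDl lerD ?T'c//.
have /Tb : K_ W (cmul p f) /\ exists W', [/\ forall i, nbhs (x i) W', W' `<=` W
    & forall y, W' y -> cmul p f y = 0].
  split; first exact: K_cmull.
  exists (W `&` [set y | f y = 0]); split=> [i|y []//|y [_ /= fy]].
    by apply: filterI => //; exact/J_near.
  by rewrite cmulE fy mulr0.
move/le_trans; apply; rewrite -mulrA.
apply: le_trans (ler_wpM2r (normr_ge0 _) (ler_norm b)) _.
by rewrite ler_wpM2l ?cmul_norm.
Qed.

Lemma bounded_on_locally_constant_at :
  (forall a, singularity_point T a -> exists i, a = x i) -> bounded_on T L.
Proof.
move=> /bounded_on_J/bounded_on_gt0[c c0 Tc].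
have [|e eW] := @bump_family_exists (fun=> setT).
  by move=> i; exact: filterT.
(* The first term bounds the part vanishing near the [x i], the second the combination of the
   [e i]. *)
exists (c * (1 + \sum_i `|e i|) + \sum_i `|T (e i)|) => f Lf.
have sumle (V : normedModType R) (v : 'I_n -> V) :
    `|\sum_i f (x i) *: v i| <= (\sum_i `|v i|) * `|f|.
  rewrite mulr_suml (le_trans (ler_norm_sum _ _ _))// ler_sum// => i _.
  by rewrite normrZ mulrC ler_wpM2l ?Cfun_norm_ub.
rewrite -[f in T f](subrK (\sum_j f (x j) *: e j)) linearD.
rewrite (le_trans (ler_normD _ _))// mulrDl lerD//; last first.
  by rewrite linear_sum; under eq_bigr do rewrite linearZ; exact: sumle.
apply: le_trans (Tc _ (J_bump_family_sub eW Lf)) _.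
rewrite -mulrA ler_wpM2l ?(ltW c0)// (le_trans (ler_normB _ _))//.
by rewrite mulrDl mul1r lerD2l; exact: sumle.
Qed.

(** * The continuous extension, called [S] here and [R0] in the theorem *)

Context (S : {linear C -> F}).
Hypothesis S_bounded : bounded_on S setT.
Hypothesis S_eq : forall h, L h -> S h = T h.

Lemma extension_disjoint f g : vdisjoint f g -> vdisjoint (S f) (S g).
Proof.
move=> fg; have [c c0 Sc] := bounded_on_gt0 S_bounded.
apply: vdisjoint_approx => d d0.
have d'0 : 0 < d / c by rewrite divr_gt0.
have [h [k [[Lh Lk] fh gk hk _]]] := disjoint_locally_constant_approx d'0 fg.
have cd u : `|u| <= d / c -> `|S u| <= d.
  by move=> ud; rewrite (le_trans (Sc u I))// -ler_pdivlMl// mulrC.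
exists (S h), (S k); split; rewrite -?linearB; [exact: cd|exact: cd|].
by rewrite !S_eq//; exact: T_dp.
Qed.

(** [T f] cannot be approximated, [T] being possibly discontinuous; only [g] is replaced, by some
    [k] in [L] that is disjoint from [f]. *)
Lemma extension_disjoint_l f g : vdisjoint f g -> (forall i, g (x i) = 0) ->
  vdisjoint (T f) (S g).
Proof.
move=> fg gx; have [c c0 Sc] := bounded_on_gt0 S_bounded.
apply: vdisjoint_approx => d d0.
have d'0 : 0 < d / c by rewrite divr_gt0.
have [h [k [[Lh Lk] fh gk _ /(_ gx) fk]]] :=
  disjoint_locally_constant_approx d'0 fg.
exists (T f), (S k); split; first by rewrite subrr normr0 ltW.
  by rewrite -linearB (le_trans (Sc _ I))// -ler_pdivlMl// mulrC.
by rewrite S_eq//; exact: T_dp.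
Qed.

(* If one of [f], [g] does not vanish at [x i], the other one vanishes near
   [x i] and is killed; otherwise both vanish at all the points [x j]. *)
Lemma singular_part_disjoint e W i f g : bump_family e W -> vdisjoint f g ->
  vdisjoint (T (cmul (e i) f) - S (cmul (e i) f))
            (T (cmul (e i) g) - S (cmul (e i) g)).
Proof.
move=> eW.
have kill (u v : C) : vdisjoint u v -> u (x i) <> 0 ->
    T (cmul (e i) v) - S (cmul (e i) v) = 0.
  move=> /Cfun_vdisjointP uv ui; rewrite S_eq ?subrr//.
  apply: J_locally_constant_at; apply: (J_bump_family_mul eW); apply/J_near.
  by apply: filterS (Cfun_near_neq0 ui) => y uy; have [] := uv y.
have vanish (u : C) : u (x i) = 0 -> forall j, cmul (e i) u (x j) = 0.
  move=> ui j; rewrite cmulE; have [<-|ij] := eqVneq i j.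
    by rewrite ui mulr0.
  have /nbhs_singleton[_ /(_ i ij) ->] := bump_family_near j eW.
  by rewrite mul0r.
move=> fg; have [fi|/eqP/(kill _ _ fg) ->] := eqVneq (f (x i)) 0; last first.
  by apply: vdisjointC; exact: vdisjoint0.
have [gi|/eqP/(kill _ _ (vdisjointC fg)) ->] := eqVneq (g (x i)) 0; last first.
  exact: vdisjoint0.
have efg : vdisjoint (cmul (e i) f) (cmul (e i) g).
  apply/Cfun_vdisjointP => y; rewrite !cmulE.
  by have /Cfun_vdisjointP/(_ y)[->|->] := fg; rewrite mulr0; [left|right].
(* Four pairs remain: [T] with [T], two mixed ones, for functions vanishing at every [x j], and [S]
   with [S]. *)
apply: vdisjointB; apply: vdisjointC; apply: vdisjointB.
- by apply: vdisjointC; exact: T_dp.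
- by apply: vdisjointC; apply: extension_disjoint_l => //; exact: vanish.
- by apply: extension_disjoint_l; [exact: vdisjointC|exact: vanish].
- by apply: vdisjointC; exact: extension_disjoint.
Qed.

(* Otherwise [T] coincides near [x i] with the bounded operator [S]. *)
Lemma singular_part_neq0 e W i : bump_family e W -> singularity_point T (x i) ->
  exists2 f, M_ (x i) f & T (cmul (e i) f) - S (cmul (e i) f) <> 0.
Proof.
move=> eW /singularity_pointP Ti; apply: contrapT => H.
have M0 f : M_ (x i) f -> T (cmul (e i) f) = S (cmul (e i) f).
  move=> fi; apply: subr0_eq; apply: contrapT => fn0.
  by apply: H; exists f.
have Le : L (cmul (e i) (cone R X)).
  move=> j; have near_e := bump_family_near j eW.
  have [e1 e0] := nbhs_singleton near_e.
  apply: filterS near_e => y [ey1 ey0]; rewrite !cmulE !coneE.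
  by have [->|ij] := eqVneq i j; rewrite ?e1 ?ey1// e0// ey0.
have [_ /(_ i) ei _ _] := eW.
apply: (Ti _ ei); have [c Sc] := S_bounded; exists c => f Uf.
suff -> : T f = S f by exact: Sc.
(* Since [f] is supported where [e i = 1], it equals [e i * f]. Splitting off the constant [f (x i)]
   leaves a multiple of [e i], which is in [L], and a product with an element of [M_ (x i)]. *)
have {1 2}-> : f = cmul (e i) (f (x i) *: cone R X + (f - f (x i) *: cone R X)).
  rewrite addrC subrK; apply: Cfun_eqP => y; rewrite cmulE.
  by have [->|/eqP ey] := eqVneq (e i y) 1; rewrite ?mul1r// Uf ?mulr0.
rewrite cmul_linear !linearP S_eq//; congr (_ + _); apply: M0.
by rewrite /M_/= CfunDE CfunNE CfunZE coneE mulr1 subrr.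
Qed.

End operator.

End decomposition.

Theorem theorem4p3 (R : realType) (X : compactHausdorffType)
    (F : banachLatticeType R) (T : {linear Cfun X R -> F})
    (T_dp : disjointness_preserving T) :
  [/\ singularity_set T = set0 <-> continuous T,
      finite_set (singularity_set T)
    & forall (n : nat) (x : 'I_n -> X),
        singularity_set T !=set0 -> injective x ->
        singularity_set T = [set x i | i in [set: 'I_n]] ->
        exists (R0 : {linear Cfun X R -> F})
               (S : 'I_n -> {linear Cfun X R -> F}),
          [/\ continuous R0,
              disjointness_preserving R0,
              forall i, disjointness_preserving (S i),
              forall f, T f = R0 f + \sum_(i < n) S i f
            & forall i,
                (exists2 f, M_ (x i) f & S i f <> 0) /\
                (forall f, J_ (x i) f -> S i f = 0)]].
Proof.
split; first split=> [T0|cT].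
- apply/continuous_bounded_on; apply: locally_bounded_continuous => x.
  apply: not_singularity_point => Tx.
  by have : singularity_set T x by []; rewrite T0.
- apply/seteqP; split=> // x /singularity_pointP Tx; apply: (Tx setT).
    exact: filterT.
  by apply: bounded_on_sub ((continuous_bounded_on T).1 cT).
- exact: finite_singularity_set.
move=> n x _ x_inj Tx.
have sing_x a : singularity_point T a -> exists i, a = x i.
  move=> Ta; have : singularity_set T a by [].
  by rewrite Tx => -[i _ <-]; exists i.
have x_sing i : singularity_point T (x i).
  by have : singularity_set T (x i) by rewrite Tx; exists i.
have [||R0 cR0 R0E] := bounded_on_extend _ _
    (bounded_on_locally_constant_at x_inj T_dp sing_x).
- exact: locally_constant_atDZ.
- move=> f d d0.
  (* Density of [L] is the approximation of the disjoint pair [f], [0]. *)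
  have f0 : vdisjoint f 0 by apply: vdisjointC; exact: vdisjoint0.
  have [h [k [[Lh _] fh _ _ _]]] :=
    disjoint_locally_constant_approx x_inj d0 f0.
  by exists h.
have bR0 := (continuous_bounded_on R0).1 cR0.
have [|e eW] := bump_family_exists R x_inj (W := fun=> setT).
  by move=> i; exact: filterT.
have exS i : exists S : {linear Cfun X R -> F}, forall f,
    S f = T (cmul (e i) f) - R0 (cmul (e i) f).
  apply: (@exists_linear R _ _ (fun f => T (cmul (e i) f) - R0 (cmul (e i) f))).
  move=> a f g; rewrite cmul_linear linearP (linearP R0) opprD addrACA.
  by rewrite -scalerBr.
have [S SE] := choice exS.
exists R0, S; split=> //.
- exact: (extension_disjoint x_inj T_dp bR0 R0E).
- move=> i f g fg; rewrite !SE.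
  exact: (singular_part_disjoint x_inj T_dp bR0 R0E i eW).
(* The sum is [T - R0] at the sum of the [e i * f], which differs from [f] by an element of [L]. *)
- move=> f; under eq_bigr do rewrite SE.
  rewrite sumrB -!linear_sum addrCA -linearB R0E; last first.
    exact: (J_locally_constant_at (J_bump_family_mulB f eW)).
  by rewrite linearB addrC subrK.
move=> i; split=> [|f fi].
  have [f fi fn0] := singular_part_neq0 bR0 R0E eW (x_sing i).
  by exists f => //; rewrite SE.
rewrite SE R0E ?subrr//.
by apply: J_locally_constant_at (J_bump_family_mul eW fi).
Qed.
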